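(* Let $K$ be a number field with ring of integers $\mathcal{O}_K$, and let $I \subseteq \mathcal{O}_K$ be an ideal. Suppose that the ideal class group $Cl(K)$ is cyclic of order $h$. Then there exist $\gamma \in \mathcal{O}_K$, distinct ideals $T_1, \dots, T_m$ of $\mathcal{O}_K$, and non-negative integers $c_1, \dots, c_m$ with $c_1 + \cdots + c_m \le h-1$, such that $$I = (\gamma)\, T_1^{c_1} \cdots T_m^{c_m},$$ where for each $i$, either $T_i$ is a non-principal prime ideal or $T_i = \mathcal{O}_K$.
   Context: $(\gamma)$ denotes the principal ideal of $\mathcal{O}_K$ generated by $\gamma$. For an ideal $T$, $T^0 = \mathcal{O}_K$. *)

(* Defs.v *)
From HB Require Import structures.
From mathcomp Require Import all_boot all_order all_algebra all_field.
From mathcomp Require Import all_classical.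

Set Implicit Arguments.
Unset Strict Implicit.
Unset Printing Implicit Defensive.

Import GRing.Theory.
Local Open Scope classical_set_scope.
Local Open Scope ring_scope.
Local Open Scope quotient_scope.

Section SetProduct.
Variable R : comNzRingType.
Implicit Types (A B C D : set R) (x : R).

Definition mulset A B : set R :=
  [set x | exists s : seq (R * R),
     (forall p, p \in s -> A p.1 /\ B p.2) /\ x = \sum_(p <- s) p.1 * p.2].

Lemma mulset_mem A B x y : A x -> B y -> mulset A B (x * y).
Proof.
move=> Ax By; exists [:: (x, y)]; split; last by rewrite big_seq1.
by move=> p; rewrite inE => /eqP->.
Qed.

Lemma mulset0 A B : mulset A B 0.
Proof. by exists [::]; split=> //; rewrite big_nil. Qed.

Lemma mulsetD A B x y : mulset A B x -> mulset A B y -> mulset A B (x + y).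
Proof.
move=> [s [sAB ->]] [t [tAB ->]]; exists (s ++ t); split; last by rewrite big_cat.
by move=> p; rewrite mem_cat => /orP[/sAB|/tAB].
Qed.

Lemma mulset_min A B D :
  D 0 -> (forall x y, D x -> D y -> D (x + y)) ->
  (forall a b, A a -> B b -> D (a * b)) -> mulset A B `<=` D.
Proof.
move=> D0 DD DM x [s [sAB ->]]; rewrite big_seq.
by elim/big_ind: _ => // p /sAB[? ?]; apply: DM.
Qed.

Lemma mulset_comm : commutative mulset.
Proof.
suff sub A B : mulset A B `<=` mulset B A by move=> A B; apply/seteqP; split.
apply: mulset_min; [exact: mulset0 | by move=> *; apply: mulsetD |].
by move=> a b Aa Bb; rewrite mulrC; apply: mulset_mem.
Qed.

Lemma mulset_assoc : associative mulset.
Proof.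
have sub A B C : mulset A (mulset B C) `<=` mulset (mulset A B) C.
  apply: mulset_min => [|x y|a u Aa]; [exact: mulset0 | exact: mulsetD |].
  apply: (@mulset_min _ _ [set u | mulset (mulset A B) C (a * u)]) => [|x y|b c Bb Cc] /=.
  - by rewrite mulr0; apply: mulset0.
  - by rewrite mulrDr; apply: mulsetD.
  - by rewrite mulrA; do 2!apply: mulset_mem => //.
move=> A B C; apply/seteqP; split; first exact: sub.
rewrite (mulset_comm _ C) (mulset_comm A B) (mulset_comm A) (mulset_comm B C).
exact: sub.
Qed.

End SetProduct.

Section Ideals.
Variable R : comNzRingType.

Definition is_ideal (I : set R) : Prop :=
  [/\ I 0, forall x y, I x -> I y -> I (x + y) & forall a x, I x -> I (a * x)].

Definition principal (a : R) : set R := [set x | exists b, x = b * a].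

Definition is_principal (I : set R) : Prop := exists a, I = principal a.

Definition is_prime_ideal (P : set R) : Prop :=
  [/\ is_ideal P, ~ P 1 & forall x y, P (x * y) -> P x \/ P y].

Definition expset (I : set R) (n : nat) : set R := iter n (mulset I) setT.

End Ideals.

Section RingOfIntegers.
Variable K : fieldExtType rat.

Definition algint : {pred K} :=
  fun z => `[< integralOver (intr : int -> K) z >].

Lemma algintP z : reflect (integralOver (intr : int -> K) z) (z \in algint).
Proof. exact: asboolP. Qed.

Lemma algint_subring : subring_closed algint.
Proof.
split=> [|x y /algintP xi /algintP yi|x y /algintP xi /algintP yi].
- by apply/algintP; apply: integral1.
- by apply/algintP; apply: integral_sub.
- by apply/algintP; apply: integral_mul.
Qed.

Record ringOfIntegers : Type := RingOfIntegers {
  algint_val : K;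
  algint_valP : algint_val \in algint
}.

HB.instance Definition _ := [isSub for algint_val].
HB.instance Definition _ := [Choice of ringOfIntegers by <:].
HB.instance Definition _ :=
  GRing.SubChoice_isSubComNzRing.Build K algint ringOfIntegers algint_subring.

End RingOfIntegers.

Section FractionalIdeals.
Variable K : fieldExtType rat.
Local Notation OK := (ringOfIntegers K).
Implicit Types A B C : set K.

Definition is_fractional A : Prop :=
  [/\ A 0,
      forall x y, A x -> A y -> A (x + y),
      forall (a : OK) x, A x -> A (val a * x),
      exists2 x, A x & x != 0
    & exists2 d : OK, d != 0 & forall x, A x -> val d * x \in @algint K].

Record fractionalIdeal : Type := FractionalIdeal {
  frac_set :> set K;
  frac_setP : `[< is_fractional frac_set >]
}.

HB.instance Definition _ := [isSub for frac_set].
HB.instance Definition _ := [Choice of fractionalIdeal by <:].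

Lemma fracP (A : fractionalIdeal) : is_fractional A.
Proof. exact/asboolP/frac_setP. Qed.

Definition frac_principal_set (x : K) : set K :=
  [set y | exists a : OK, y = val a * x].

Lemma frac_principal1_mul A :
  is_fractional A -> mulset (frac_principal_set 1) A = A.
Proof.
case=> A0 AD AZ _ _; apply/seteqP; split.
  by apply: mulset_min => // x y [a ->] Ay; rewrite mulr1; apply: AZ.
move=> x Ax; rewrite -[x]mul1r; apply: mulset_mem => //.
by exists 1; rewrite rmorph1 mulr1.
Qed.

Lemma frac_principal_mul x y :
  mulset (frac_principal_set x) (frac_principal_set y) =
  frac_principal_set (x * y).
Proof.
apply/seteqP; split.
  apply: mulset_min => [|u v [a ->] [b ->]|u v [a ->] [b ->]].
  - by exists 0; rewrite rmorph0 mul0r.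
  - by exists (a + b); rewrite rmorphD mulrDl.
  - by exists (a * b); rewrite rmorphM /= mulrACA.
move=> _ [a ->]; rewrite mulrA; apply: mulset_mem; first by exists a.
by exists 1; rewrite rmorph1 mul1r.
Qed.

Lemma frac_principal1P : is_fractional (frac_principal_set 1).
Proof.
split.
- by exists 0; rewrite rmorph0 mul0r.
- by move=> _ _ [a ->] [b ->]; exists (a + b); rewrite rmorphD mulrDl.
- by move=> c _ [a ->]; exists (c * a); rewrite rmorphM mulrA.
- by exists 1; [exists 1; rewrite rmorph1 mulr1 | exact: oner_neq0].
- exists 1; first exact: oner_neq0.
  by move=> _ [a ->]; rewrite rmorph1 mul1r mulr1; apply: valP.
Qed.

Definition frac1 : fractionalIdeal :=
  FractionalIdeal (asboolT frac_principal1P).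

Lemma mulset_fractional A B :
  is_fractional A -> is_fractional B -> is_fractional (mulset A B).
Proof.
move=> [A0 AD AZ [a Aa a0] [d d0 Ad]] [B0 BD BZ [b Bb b0] [e e0 Be]].
split.
- exact: mulset0.
- by move=> x y; apply: mulsetD.
- move=> c; apply: (@mulset_min _ _ _ [set x | mulset A B (val c * x)]) => /= [|x y|x y Ax By].
  + by rewrite mulr0; apply: mulset0.
  + by rewrite mulrDr; apply: mulsetD.
  + by rewrite mulrA; apply: mulset_mem => //; apply: AZ.
- by exists (a * b); [apply: mulset_mem | rewrite mulf_neq0].
- have [dv0 ev0] : val d != 0 /\ val e != 0.
    have val0 : val (0 : OK) = 0 by rewrite rmorph0.
    by split; rewrite -val0 (inj_eq val_inj).
  exists (d * e).
    by rewrite -(inj_eq val_inj) rmorph0 rmorphM mulf_neq0.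
  have [alg1 algB algM] := @algint_subring K.
  have valM : val (d * e) = val d * val e by rewrite rmorphM.
  apply: (@mulset_min _ A B [set x | val (d * e) * x \in @algint K]) => /=.
  + by rewrite mulr0 -(rmorph0 (val : OK -> K)); apply: valP.
  + move=> x y xi yi; rewrite mulrDr.
    have -> : val (d * e) * x + val (d * e) * y =
              val (RingOfIntegers xi + RingOfIntegers yi) by rewrite rmorphD.
    exact: valP.
  + by move=> x y Ax By; rewrite [X in X * _]valM mulrACA algM ?Ad ?Be.
Qed.

Definition fracM (A B : fractionalIdeal) : fractionalIdeal :=
  FractionalIdeal (asboolT (mulset_fractional (fracP A) (fracP B))).

End FractionalIdeals.

Section ClassGroup.
Variable K : fieldExtType rat.
Implicit Types A B C : fractionalIdeal K.

Definition frac_rel : rel (fractionalIdeal K) := fun A B =>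
  `[< exists2 x : K, x != 0 & frac_set A = mulset (frac_principal_set x) B >].

Lemma frac_rel_refl : reflexive frac_rel.
Proof.
move=> A; apply/asboolP; exists 1; first exact: oner_neq0.
by rewrite frac_principal1_mul //; apply: fracP.
Qed.

Lemma frac_rel_sym : symmetric frac_rel.
Proof.
suff sub A B : frac_rel A B -> frac_rel B A.
  by move=> A B; apply/idP/idP; apply: sub.
move=> /asboolP[x x0 AB]; apply/asboolP; exists x^-1; first by rewrite invr_neq0.
rewrite AB mulset_assoc frac_principal_mul mulVf // frac_principal1_mul //.
exact: fracP.
Qed.

Lemma frac_rel_trans : transitive frac_rel.
Proof.
move=> B A C /asboolP[x x0 AB] /asboolP[y y0 BC]; apply/asboolP.
by exists (x * y); rewrite ?mulf_neq0 // AB BC mulset_assoc frac_principal_mul.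
Qed.

Canonical frac_equiv :=
  EquivRel frac_rel frac_rel_refl frac_rel_sym frac_rel_trans.

Definition classGroup : Type := {eq_quot frac_rel}.

HB.instance Definition _ := Choice.on classGroup.
HB.instance Definition _ := EqQuotient.on classGroup.

Definition class_of (A : fractionalIdeal K) : classGroup := \pi_classGroup A.

Lemma class_ofP A B :
  (class_of A = class_of B) <->
  exists2 x : K, x != 0 & frac_set A = mulset (frac_principal_set x) B.
Proof.
by split=> [/eqP|?]; [rewrite eqmodE => /asboolP | apply/eqP; rewrite eqmodE; apply/asboolP].
Qed.

Definition classM (x y : classGroup) : classGroup :=
  class_of (fracM (repr x) (repr y)).

Lemma classM_of A B : classM (class_of A) (class_of B) = class_of (fracM A B).
Proof.
apply/class_ofP => /=.
have /class_ofP[x x0 ->] : class_of (repr (class_of A)) = class_of A by exact: reprK.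
have /class_ofP[y y0 ->] : class_of (repr (class_of B)) = class_of B by exact: reprK.
exists (x * y); first by rewrite mulf_neq0.
rewrite -frac_principal_mul -!mulset_assoc; congr mulset.
by rewrite !mulset_assoc; congr mulset; apply: mulset_comm.
Qed.

Lemma class_ofE x : exists A, x = class_of A.
Proof. by exists (repr x); rewrite /class_of reprK. Qed.

Lemma classMA : associative classM.
Proof.
move=> x y z; have [A ->] := class_ofE x; have [B ->] := class_ofE y.
have [C ->] := class_ofE z; rewrite !classM_of; congr class_of.
by apply: val_inj => /=; apply: mulset_assoc.
Qed.

Lemma classMC : commutative classM.
Proof.
move=> x y; have [A ->] := class_ofE x; have [B ->] := class_ofE y.
rewrite !classM_of; congr class_of.
by apply: val_inj => /=; apply: mulset_comm.
Qed.

Lemma class1M : left_id (class_of (frac1 K)) classM.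
Proof.
move=> x; have [A ->] := class_ofE x; rewrite classM_of; congr class_of.
by apply: val_inj => /=; rewrite frac_principal1_mul //; apply: fracP.
Qed.

Lemma classM1 : right_id (class_of (frac1 K)) classM.
Proof. by move=> x; rewrite classMC class1M. Qed.

(* That every class is invertible is a theorem about Dedekind domains, so only
   the monoid structure is declared here. *)
HB.instance Definition _ :=
  isMonoid.Build classGroup classMA class1M classM1.

End ClassGroup.

(* [x * g ^+ n = 1] says [x = g ^- n]: the exponent of the generator ranges over
   the integers, but inverses are not part of the structure of [G]. *)
Definition cyclic_of_order (G : monoidType) (h : nat) : Prop :=
  (exists g : G, forall x : G,
     exists n : nat, x = (g ^+ n)%g \/ (x * g ^+ n)%g = 1%g)
  /\ ([set: G] #= `I_h)%card.

(* Main.v *)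
(* The class group enters only through the pigeonhole principle. Every nonzero
   ideal of the ring of integers has finite index, because for a prime [p] a
   rational linear relation can be made primitive, hence nontrivial modulo [p];
   so ideals are finitely generated and satisfy the ascending chain condition.
   If two powers [I^i] and [I^(i+d)] of a nonzero ideal lie in the same class,
   then integral closedness and Nakayama's lemma make [I^d] principal; so [I] is
   invertible, containment is divisibility, and noetherian induction yields
   factorization into primes. Write an ideal as [(c) P_1 ... P_k] with [P_i]
   prime and nonprincipal and [k] minimal. If [k >= h], two of the [h + 1]
   ideals [P_1 ... P_i] with [0 <= i <= h] lie in the same class, so some block
   [P_(i+1) ... P_j] is principal and can be absorbed into [c]. *)
Require Import Defs.
From HB Require Import structures.
From mathcomp Require Import all_boot all_order all_algebra all_fingroup.
From mathcomp Require Import all_field.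
From mathcomp Require Import all_classical.

Set Implicit Arguments.
Unset Strict Implicit.
Unset Printing Implicit Defensive.

Import GRing.Theory Num.Theory.
Local Open Scope classical_set_scope.
Local Open Scope ring_scope.

(** * Arithmetic of [OK] and finiteness of its quotients by positive integers *)

Section IntegersArith.
Variable K : fieldExtType rat.
Local Notation OK := (ringOfIntegers K).
Implicit Types (a b c x y z : OK).

Lemma val_eq0 a : (val a == 0) = (a == 0).
Proof. by rewrite -(inj_eq val_inj) rmorph0. Qed.

Lemma OK_valM a b : val (a * b) = val a * val b.
Proof. exact: rmorphM. Qed.

Lemma OK_mul_eq0 a b : (a * b == 0) = (a == 0) || (b == 0).
Proof. by rewrite -!val_eq0 rmorphM mulf_eq0. Qed.

Lemma OK_mulfI a : a != 0 -> injective ( *%R a).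
Proof.
move=> a0 b c /eqP; rewrite -subr_eq0 -mulrBr OK_mul_eq0 (negbTE a0) /=.
by rewrite subr_eq0 => /eqP.
Qed.

(** In a monic integral equation of [a], factors [X] are cancelled, [OK] being a domain, until the
    constant term is nonzero; this term is then a multiple of [a]. *)
Lemma nonzero_int_multiple a : a != 0 ->
  exists2 n : nat, (0 < n)%N & exists b, n%:R = b * a.
Proof.
move=> a0; have /algintP[p mp rp] : val a \in @algint K by exact: valP.
suff [m m0 [b mb]] : exists2 m : int, m != 0 & exists b, m%:~R = b * a.
  exists `|m|%N; first by rewrite absz_gt0.
  rewrite -[_%:R]/((`|m|%N : int)%:~R) abszE.
  have [_|_] := ger0P m; first by exists b.
  by exists (- b); rewrite rmorphN /= mb mulNr.
have : p != 0 by exact: monic_neq0.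
have {rp}/eqP : (map_poly (intr : int -> OK) p).[a] = 0.
  apply: val_inj; rewrite rmorph0 -[RHS](rootP rp) -horner_map.
  by congr _.[_]; apply/polyP => i; rewrite !coef_map; exact: rmorph_int.
elim/poly_ind: p {mp} => [|p m IH]; first by rewrite eqxx.
rewrite rmorphD rmorphM /= map_polyX map_polyC /= hornerD hornerMX hornerC.
have [->|m0 pa _] := eqVneq m 0; last first.
  exists (- m); first by rewrite oppr_eq0.
  exists (map_poly intr p).[a]; rewrite rmorphN /=; apply/eqP.
  by rewrite eq_sym -addr_eq0.
rewrite polyC0 rmorph0 !addr0 OK_mul_eq0 (negbTE a0) orbF => pa p0.
by apply: IH => //; apply: contra p0 => /eqP->; rewrite mul0r.
Qed.

(** More than $\dim K$ elements are dependent over the rationals; clearing denominators and dividing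
    by the content leaves coefficients not all divisible by [p]. *)
Lemma primitive_relation (p k : nat) (x : nat -> OK) :
  prime p -> (\dim {:K} < k)%N ->
  exists2 a : nat -> int, \sum_(i < k) x i *~ a i = 0
    & exists i : 'I_k, ~~ (p %| a i)%Z.
Proof.
move=> p_pr kd; pose X := [tuple val (x i) | i < k].
have : ~~ free X.
  apply/negP => fX.
  have : (\dim <<X>> <= \dim {:K})%N by apply/dimvS/subvf.
  by move: fX; rewrite /free => /eqP->; rewrite size_tuple leqNgt kd.
move/freeP/existsNP=> [q /not_implyP[q0 /existsNP[i0 qi0]]].
(* The coefficients are packed into a polynomial so that contents and primitive parts apply. *)
pose Q := \poly_(i < k) (if insub i is Some j then q j else 0).
have QE (i : 'I_k) : Q`_i = q i.
  by rewrite coef_poly ltn_ord insubT // => lti; congr q; apply: val_inj.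
have [P [d d0 QP]] := rat_poly_scale Q.
have P0 : P != 0.
  by apply/eqP=> P0; apply: qi0; rewrite -QE QP P0 rmorph0 scaler0 coef0.
pose R := zprimitive P; exists (fun i => R`_i).
  have [u u0 PE] : exists2 u : int, u != 0 & P = u *: R.
    by exists (zcontents P); [rewrite zcontents_eq0 | exact: zpolyEprim].
  have XE (i : 'I_k) : X`_i = val (x i) by rewrite -tnth_nth tnth_mktuple.
  apply: val_inj; rewrite rmorph0 rmorph_sum.
  have ud0 : u%:~R / d%:~R != 0 :> rat by rewrite mulf_neq0 ?invr_eq0 ?intr_eq0.
  apply: (scalerI ud0); rewrite scaler0 -[RHS]q0 scaler_sumr.
  apply: eq_bigr => i _; rewrite -QE QP XE rmorphMz -scaler_int scalerA.
  congr (_ *: _); rewrite coefZ coef_map /= [in RHS]PE coefZ intrM mulrA.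
  by rewrite (mulrC u%:~R).
(* A primitive polynomial has content 1, which [p] cannot divide. *)
apply: contrapT => /forallNP Rp; have : (p %| zcontents R)%Z.
  rewrite dvdz_contents; apply/polyOverP => i.
  have [lti|lei] := ltnP i k; first exact/negPn/negP/(Rp (Ordinal lti)).
  rewrite nth_default ?dvdz0 // size_zprimitive (leq_trans _ lei) //.
  have : (size Q <= k)%N by apply: size_poly.
  by rewrite QP size_scale ?invr_eq0 ?intr_eq0 // size_map_inj_poly //;
    apply: intr_inj.
by rewrite zcontents_primitive P0 dvdzE /= dvdn1 => /eqP p1; rewrite p1 in p_pr.
Qed.

(** Finiteness of $O_K/NO_K$: [s] meets every class, possibly more than once. *)
Definition finite_mod (N : nat) : Prop :=
  exists s : seq OK, forall x, exists2 y, y \in s & exists z, x = y + N%:R * z.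

(** A largest family independent modulo [p] spans $O_K/pO_K$ over $\mathbb{F}_p$, so its
    combinations with coefficients below [p] meet every class. *)
Lemma finite_mod_prime p : prime p -> finite_mod p.
Proof.
move=> p_pr.
(* Linear independence over $\mathbb{F}_p$ of the images in $O_K/pO_K$; [primitive_relation] bounds
   [k]. *)
pose indep k := exists x : nat -> OK, forall a : nat -> int,
  (exists y, \sum_(i < k) x i *~ a i = p%:R * y) ->
  forall i : 'I_k, (p %| a i)%Z.
have ex_indep : exists k, `[< indep k >].
  by exists 0%N; apply/asboolP; exists (fun=> 0) => a _ [].
have indep_dim k : `[< indep k >] -> (k <= \dim {:K})%N.
  move=> /asboolP[x xP]; rewrite leqNgt;
    apply/negP => /(primitive_relation x p_pr).
  move=> [a a0 [i /negP]]; apply; apply: xP.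
  by exists 0; rewrite a0 mulr0.
have [k /asboolP[x xP] k_max] := ex_maxnP ex_indep indep_dim.
have p0 : (0 < p)%N by exact: prime_gt0.
exists [seq \sum_(i < k) x i *+ (f i : 'I_p) | f : {ffun 'I_k -> 'I_p}] => z.
suff [b [y zE]] : exists b : nat -> int, exists y,
    z = \sum_(i < k) x i *~ b i + p%:R * y.
  have bp (i : 'I_k) : (`|(b i %% p)%Z|%N < p)%N.
    by rewrite -ltz_nat gez0_abs ?ltz_pmod ?modz_ge0 // -lt0n.
  exists (\sum_(i < k) x i *+ ([ffun i => Ordinal (bp i)] i : 'I_p)).
    by apply: map_f; rewrite mem_enum.
  exists (y + \sum_(i < k) x i *~ (b i %/ p)%Z).
  rewrite mulrDr addrCA addrC zE; congr (_ + _).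
  rewrite mulr_sumr -big_split; apply: eq_bigr => i _; rewrite ffunE /=.
  rewrite pmulrn gez0_abs ?modz_ge0 //; last by rewrite -lt0n.
  rewrite {1}(divz_eq (b i) p) mulrzDr [LHS]addrC; congr (_ + _).
  by rewrite mulrzA -pmulrn mulr_natl.
(* Appending [z] to a family of maximal size destroys its independence. *)
have [a [[y ay] [j aj]]] : exists a : nat -> int,
    (exists y, \sum_(i < k) x i *~ a i + z *~ a k = p%:R * y) /\
    exists j : 'I_k.+1, ~~ (p %| a j)%Z.
  apply: contrapT => na; have : (k.+1 <= k)%N; last by rewrite ltnn.
  apply: k_max; apply/asboolP;
    exists (fun i => if i == k then z else x i) => a ya i.
  apply/negPn/negP => ai; apply: na; exists a; split; last by exists i.
  have [y] := ya; rewrite big_ord_recr /= eqxx => ayE; exists y; rewrite -ayE;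
    congr (_ + _).
  by apply: eq_bigr => l _; rewrite ltn_eqF.
(* If [p] divided [a k], the relation would reduce to one among the [x i], and [p] would divide all
   its coefficients. *)
have ak : ~~ (p %| a k)%Z.
  apply/negP => /dvdzP[q akE]; move: aj.
  have [jk|jk] := eqVneq (j : nat) k; first by rewrite jk akE dvdz_mull.
  have jk' : (j < k)%N by rewrite ltn_neqAle jk -ltnS ltn_ord.
  move=> /negP; apply; apply: (xP a _ (Ordinal jk')).
  exists (y - z *~ q);
    rewrite mulrBr -ay akE mulrzA -[z *~ q *~ p]/(z *~ q *+ p).
  by rewrite mulr_natl addrK.
(* [u] inverts [a k] modulo [p], so the relation can be solved for [z]. *)
have [u [v uv]] : exists u v : int, u * a k + v * p = 1.
  have [u [v uv]] := Bezoutz (a k) p; exists u, v; rewrite uv.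
  apply/eqP;
    rewrite -[_ == _]/(coprimez _ _) coprimezE coprime_sym prime_coprime //.
exists (fun i => - u * a i), (y *~ u + z *~ v).
rewrite -[LHS]/(z *~ 1) -uv mulrzDr (mulrC u) !mulrzA.
have -> : z *~ a k = p%:R * y - \sum_(i < k) x i *~ a i
  by rewrite -ay addrC addKr.
have -> : z *~ v *~ p = p%:R * (z *~ v) by rewrite -pmulrn mulr_natl.
rewrite mulrzBl -mulrzAr mulrz_suml addrAC -mulrDr addrC -sumrN; congr (_ + _).
by apply: eq_bigr => i _; rewrite mulNr mulrNz mulrzA_C.
Qed.

(** Representatives combine like two digits, one modulo [M] and the next modulo [N]. *)
Lemma finite_mod_mul M N : finite_mod M -> finite_mod N -> finite_mod (M * N).
Proof.
move=> [s sP] [t tP]; exists [seq y + M%:R * z | y <- s, z <- t] => x.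
have [y ys [z ->]] := sP x; have [w wt [v ->]] := tP z.
exists (y + M%:R * w); first by apply/allpairsP; exists (y, w).
by exists v; rewrite natrM mulrDr addrA mulrA.
Qed.

Lemma finite_mod_gt0 N : (0 < N)%N -> finite_mod N.
Proof.
elim/ltn_ind: N => N IH N0; have [N1|N1] := leqP N 1.
  have -> : N = 1%N by apply/eqP; rewrite eqn_leq N1 N0.
  exists [:: 0] => x; exists 0; first by rewrite inE.
  by exists x; rewrite mul1r add0r.
rewrite -(divnK (pdiv_dvd N)) mulnC; apply: finite_mod_mul.
  exact/finite_mod_prime/pdiv_prime.
apply: IH; first by rewrite ltn_Pdiv // prime_gt1 // pdiv_prime.
by rewrite divn_gt0 ?pdiv_gt0 // pdiv_leq.
Qed.

End IntegersArith.

(** * Ideals of a commutative ring as a commutative monoid *)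

Section IdealMonoid.
Variable R : comNzRingType.

(** Bundling gives a type with equality and a monoid law, as iterated products and multiplicities
    require; the boolean proof field makes ideals with equal sets equal. *)
Record ideal : Type := Ideal {
  ideal_set :> set R;
  ideal_setP : `[< is_ideal ideal_set >]
}.

Definition ideal_mem (I : ideal) : R -> Prop := ideal_set I.
Coercion ideal_mem : ideal >-> Funclass.

HB.instance Definition _ := [isSub for ideal_set].
HB.instance Definition _ := [Choice of ideal by <:].

Implicit Types (I J L : ideal) (a b x y : R).

Lemma idealP I : is_ideal I.
Proof. exact/asboolP/ideal_setP. Qed.

Lemma ideal0 I : I 0. Proof. by case: (idealP I). Qed.

Lemma idealD I x y : I x -> I y -> I (x + y).
Proof. by case: (idealP I) => _ + _; apply. Qed.

Lemma idealMl I a x : I x -> I (a * x).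
Proof. by case: (idealP I) => _ _; apply. Qed.

Lemma idealB I x y : I x -> I y -> I (x - y).
Proof.
by move=> Ix Iy; apply: idealD => //; rewrite -mulN1r; apply: idealMl.
Qed.

Lemma ideal_sum I (T : Type) (r : seq T) (P : pred T) (F : T -> R) :
  (forall i, P i -> I (F i)) -> I (\sum_(i <- r | P i) F i).
Proof.
by move=> IF; elim/big_ind: _ => //; [exact: ideal0 | exact: idealD].
Qed.

Lemma ideal_eqP I J : I `<=` J -> J `<=` I -> I = J.
Proof. by move=> IJ JI; apply: val_inj; apply/seteqP. Qed.

Lemma is_idealT : @is_ideal R setT.
Proof. by []. Qed.
Definition idealT := Ideal (asboolT is_idealT).

Lemma is_ideal_principal a : is_ideal (principal a).
Proof.
split=> [|_ _ [b ->] [c ->]|b _ [c ->]].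
- by exists 0; rewrite mul0r.
- by exists (b + c); rewrite mulrDl.
- by exists (b * c); rewrite mulrA.
Qed.
Definition pideal a := Ideal (asboolT (is_ideal_principal a)).

Lemma is_ideal_mul I J : is_ideal (mulset I J).
Proof.
split=> [|x y|a]; [exact: mulset0 | exact: mulsetD |].
apply: (@mulset_min _ I J [set x | mulset I J (a * x)]) => /= [|x y|x y Ix Jy].
- by rewrite mulr0; apply: mulset0.
- by rewrite mulrDr; apply: mulsetD.
- by rewrite mulrA; apply: mulset_mem => //; apply: idealMl.
Qed.
Definition idealM I J := Ideal (asboolT (is_ideal_mul I J)).
Local Notation "I ** J" := (idealM I J) (at level 40, left associativity).

Lemma is_ideal_add I J : is_ideal [set x + y | x in I & y in J].
Proof.
split.
- by exists 0; [exact: ideal0 | exists 0; rewrite ?addr0 //; exact: ideal0].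
- move=> _ _ [x Ix [y Jy <-]] [x' Ix' [y' Jy' <-]].
  exists (x + x'); first exact: idealD.
  by exists (y + y'); [exact: idealD | rewrite addrACA].
- move=> a _ [x Ix [y Jy <-]]; exists (a * x); first exact: idealMl.
  by exists (a * y); [exact: idealMl | rewrite mulrDr].
Qed.
Definition ideal_add I J := Ideal (asboolT (is_ideal_add I J)).

Lemma idealMA : associative idealM.
Proof. by move=> I J L; apply: val_inj; apply: mulset_assoc. Qed.

Lemma idealMC : commutative idealM.
Proof. by move=> I J; apply: val_inj; apply: mulset_comm. Qed.

Lemma mul_idealT : left_id idealT idealM.
Proof.
move=> I; apply: ideal_eqP => [|x Ix] /=.
  apply: mulset_min; [exact: ideal0 | exact: idealD |].
  by move=> a b _; apply: idealMl.
by rewrite -[x]mul1r; apply: mulset_mem.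
Qed.

HB.instance Definition _ :=
  Monoid.isComLaw.Build ideal idealT idealM idealMA idealMC mul_idealT.

Lemma pidealM a b : pideal a ** pideal b = pideal (a * b).
Proof.
apply: ideal_eqP => /= [|_ [c ->]].
  apply: mulset_min => [|_ _ [x ->] [y ->]|_ _ [x ->] [y ->]].
  - by exists 0; rewrite mul0r.
  - by exists (x + y); rewrite mulrDl.
  - by exists (x * y); rewrite mulrACA.
by rewrite mulrA; apply: mulset_mem; [exists c | exists 1; rewrite mul1r].
Qed.

Lemma pideal1 : pideal 1 = idealT.
Proof. by apply: ideal_eqP => // x _; exists x; rewrite mulr1. Qed.

Lemma pideal_mulP a I x : (pideal a ** I) x <-> exists2 y, I y & x = a * y.
Proof.
split=> [|[y Iy ->]]; last by apply: mulset_mem => //; exists 1; rewrite mul1r.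
move: x; apply: mulset_min.
- by exists 0; [exact: ideal0 | rewrite mulr0].
- move=> _ _ [y Iy ->] [z Iz ->].
  by exists (y + z); [exact: idealD | rewrite mulrDr].
- move=> _ y [b ->] Iy.
  by exists (b * y); [exact: idealMl | rewrite mulrAC mulrC].
Qed.

Lemma idealM_subr I J : I ** J `<=` J.
Proof.
apply: mulset_min; [exact: ideal0 | exact: idealD |].
by move=> x y _; apply: idealMl.
Qed.

Lemma idealMS I J L : I `<=` J -> I ** L `<=` J ** L.
Proof.
move=> IJ; apply: mulset_min; [exact: mulset0 | exact: mulsetD |].
by move=> x y /IJ; apply: mulset_mem.
Qed.

Lemma ideal_full I : I 1 -> I = idealT.
Proof.
by move=> I1; apply: ideal_eqP => // x _; rewrite -[x]mulr1; apply: idealMl.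
Qed.

Definition spanned I (b : seq R) := forall x,
  I x <-> exists m : nat -> R, x = \sum_(i < size b) m i * b`_i.

Lemma spanned_mem I (b : seq R) (i : 'I_(size b)) : spanned I b -> I b`_i.
Proof.
move=> Ib; apply/Ib; exists (fun j : nat => (j == i)%:R).
rewrite (bigD1 i) //= eqxx mul1r big1 ?addr0 // => j ji.
by rewrite val_eqE (negbTE ji) mul0r.
Qed.

(** In a product of [x] in [C] and [y] in [J], expanding [y] over the generators puts the factor [x]
    into every coefficient. *)
Lemma idealM_spanned C J (b : seq R) : spanned J b -> forall x, (C ** J) x ->
  exists2 c : nat -> R, (forall i, C (c i)) & x = \sum_(i < size b) c i * b`_i.
Proof.
move=> Jb; apply: mulset_min => [|x y [c Cc ->] [d Cd ->]|x y Cx /Jb[m ->]].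
- exists (fun=> 0) => [i|]; first exact: ideal0.
  by rewrite big1 // => i _; rewrite mul0r.
- exists (fun i => c i + d i) => [i|]; first exact: idealD.
  by rewrite -big_split; apply: eq_bigr => i _; rewrite mulrDl.
- exists (fun i => m i * x) => [i|]; first exact: idealMl.
  by rewrite mulr_sumr; apply: eq_bigr => i _; rewrite mulrCA mulrA.
Qed.

(** In the Leibniz expansion the identity contributes a product of terms $1 - A_{ii}$, which is 1
    modulo [C]; any other permutation picks an off-diagonal entry, which lies in [C]. *)
Lemma det_sub1_ideal (C : ideal) n (A : 'M[R]_n) :
  (forall i j, C (A i j)) -> C (\det (1%:M - A) - 1).
Proof.
move=> CA; have mulC x y : C x -> C (x * y) by rewrite mulrC; apply: idealMl.
rewrite /determinant (bigD1 (1%g : {perm 'I_n})) //= addrAC; apply: idealD;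
  last first.
  apply: ideal_sum => s /eqP s1.
  have [i si] : exists i, s i != i.
    apply: contrapT => /forallNP sid; apply: s1; apply/permP => i.
    by rewrite perm1; apply/eqP/negPn/negP/sid.
  rewrite (bigD1 i) //= !mxE eq_sym (negbTE si) sub0r; apply/idealMl/mulC.
  by rewrite -mulN1r; apply: idealMl.
rewrite odd_perm1 expr0 mul1r.
elim/big_rec: _ => [|i x _ Cx]; first by rewrite subrr; apply: ideal0.
by rewrite perm1 !mxE eqxx mulrBl mul1r addrAC; apply: idealB => //;
  apply: mulC.
Qed.

End IdealMonoid.

Local Notation "I ** J" := (idealM I J) (at level 40, left associativity).

(** * Finite generation, ascending chains, integral closedness and Nakayama's lemma *)

Section IntegerIdeals.
Variable K : fieldExtType rat.
Local Notation OK := (ringOfIntegers K).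
Implicit Types (I J L C : ideal OK) (a b c x y : OK).

Definition nonzero I := exists2 a, I a & a != 0.

Lemma nonzeroM I J : nonzero I -> nonzero J -> nonzero (I ** J).
Proof.
move=> [a Ia a0] [b Jb b0]; exists (a * b); first exact: mulset_mem.
by rewrite OK_mul_eq0 negb_or a0.
Qed.

Lemma nonzeroS I J : I `<=` J -> nonzero I -> nonzero J.
Proof. by move=> IJ [a Ia a0]; exists a => //; apply: IJ. Qed.

Lemma nonzeroT : nonzero (idealT OK).
Proof. by exists 1 => //; apply: oner_neq0. Qed.

Lemma nonzero_prod (T : Type) (r : seq T) (P : pred T) (F : T -> ideal OK) :
  (forall i, P i -> nonzero (F i)) ->
  nonzero (\big[@idealM OK/idealT OK]_(i <- r | P i) F i).
Proof.
by move=> F0; elim/big_ind: _ => //; [exact: nonzeroT | exact: nonzeroM].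
Qed.

(** A nonzero element has a positive integer multiple [N], and there are finitely many classes
    modulo [N]; finite generation and noetherian induction both rest on this. *)
Lemma nonzero_finite_reps I : nonzero I -> exists N : nat, exists s : seq OK,
  I N%:R /\ forall x, exists2 y, y \in s & exists z, x = y + N%:R * z.
Proof.
move=> [a Ia /nonzero_int_multiple[N N0 [b Nb]]]; exists N.
have [s sP] := finite_mod_gt0 K N0; exists s; split=> //.
by rewrite Nb; apply: idealMl.
Qed.

(** Generators are [N] and the representatives lying in [I]: if $x = y + Nz$ is in [I], so is
    [y]. *)
Lemma nonzero_spanned I : nonzero I -> exists b : seq OK, spanned I b.
Proof.
move=> /nonzero_finite_reps[N [s [IN sP]]].
pose t := [seq y <- s | `[< I y >]]; exists (N%:R :: t) => x; split; last first.
  case=> m ->; apply: ideal_sum => i _; apply: idealMl.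
  have := mem_nth 0 (ltn_ord i); rewrite inE mem_filter => /orP[/eqP->|] //.
  by move=> /andP[/asboolP].
move=> Ix; have [y ys [z xE]] := sP x.
have yt : y \in t.
  rewrite mem_filter ys andbT; apply/asboolP.
  have -> : y = x - N%:R * z by rewrite xE addrK.
  by apply: idealB => //; rewrite mulrC; apply: idealMl.
exists (fun i => if i is i'.+1 then (i' == index y t)%:R else z).
have yi : (index y t < size t)%N by rewrite index_mem.
rewrite /= big_ord_recl /= (bigD1 (Ordinal yi)) //= eqxx mul1r nth_index //.
rewrite big1 ?addr0 => [|i iy]; first by rewrite xE addrC mulrC.
by rewrite (_ : (_ == _) = false) ?mul0r //; apply: negbTE; apply: contra iy.
Qed.

(** An ideal above [I0] contains [N], so the representatives in it determine it; their number grows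
    under strict inclusion and is at most [size s]. *)
Lemma noetherian_ind (P : ideal OK -> Prop) :
  (forall I, nonzero I -> (forall J, I `<=` J -> ~ J `<=` I -> P J) -> P I) ->
  forall I, nonzero I -> P I.
Proof.
move=> IH I0 nzI0; have [N [s [I0N sP]]] := nonzero_finite_reps nzI0.
pose reps I := count (fun y => `[< I y >]) s.
suff rec n I : I N%:R -> nonzero I -> (size s - reps I < n)%N -> P I.
  exact: (rec _ _ I0N nzI0 (ltnSn _)).
elim: n I => // n rec I IN nzI; rewrite ltnS => sI;
  apply: IH => // J IJ /existsNP[x].
move=> /not_implyP[Jx nIx]; apply: rec => [||];
  [exact: IJ | exact: nonzeroS nzI |].
(* [x] lies in [J] but not in [I], and so does its representative [y], since both ideals contain
   [N]. *)
apply: leq_trans sI; have [y ys [z xE]] := sP x.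
have Nz L : L N%:R -> L (N%:R * z) by rewrite mulrC; apply: idealMl.
have Jy : J y.
  have -> : y = x - N%:R * z by rewrite xE addrK.
  by apply: idealB => //; apply/Nz/IJ.
have nIy : ~ I y by move=> Iy; apply: nIx; rewrite xE; apply: idealD => //;
  apply: Nz.
have repsJ : (reps I < reps J)%N.
  pose D := [pred y | `[< J y >] && ~~ `[< I y >]].
  have -> : reps J = (reps I + count D s)%N.
    rewrite -count_predUI [X in (_ + X)%N](@eq_count _ _ pred0); last first.
      by move=> u /=; rewrite andbCA andbN andbF.
    rewrite count_pred0 addn0; apply: eq_count => u /=.
    have [Iu|_] := asboolP (I u); last by rewrite andbT.
    by apply/asboolP/IJ.
  rewrite -[ltnLHS]addn0 ltn_add2l -has_count; apply/hasP; exists y => //=.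
  by apply/andP; split; [apply/asboolP | apply/negP => /asboolP].
by rewrite ltn_sub2l // (leq_trans repsJ) ?count_size.
Qed.

(** Multiplication by [c / a] maps the finitely generated [J] into itself, so [c / a] is an
    eigenvalue of a matrix over [OK], hence integral. *)
Lemma integral_closed J a c : nonzero J -> a != 0 ->
  (forall x, J x -> exists2 y, J y & c * x = a * y) -> exists y, c = a * y.
Proof.
move=> nzJ a0 cJ; have [b Jb] := nonzero_spanned nzJ.
have M_ex (i : 'I_(size b)) : exists m : nat -> OK,
    c * b`_i = a * \sum_(j < size b) m j * b`_j.
  have [y /Jb[m ->] ->] := cJ _ (spanned_mem i Jb); by exists m.
have [M ME] := choice M_ex.
(* Transposed, because [eigenvalue] refers to row vectors. *)
pose A : 'M[OK]_(size b) := \matrix_(j, i) M i j.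
pose w : K := val c / val a.
have va0 : val a != 0 by rewrite val_eq0.
have wA : eigenvalue (map_mx val A) w.
  apply/eigenvalueP; exists (\row_i val b`_i).
    apply/rowP => i; rewrite !mxE; apply: (mulfI va0).
    have -> : val a * (w * val b`_i) = val c * val b`_i
      by rewrite mulrA mulrCA divff ?mulr1.
    rewrite -[RHS]rmorphM ME rmorphM; congr (_ * _).
    by rewrite rmorph_sum; apply: eq_bigr => j _; rewrite !mxE mulrC rmorphM.
  (* The eigenvector is nonzero: if all generators vanished, so would [J]. *)
  have [x Jx x0] := nzJ; apply/eqP => /rowP v0.
  move/eqP: x0; apply; have [m ->] := (Jb x).1 Jx; apply: big1 => i _.
  by have := v0 i; rewrite !mxE => /eqP; rewrite val_eq0 => /eqP->;
    rewrite mulr0.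
suff : w \in @algint K.
  move=> wi; exists (RingOfIntegers wi); apply: val_inj.
  by rewrite rmorphM /= mulrC divfK.
apply/algintP; apply: (@integral_root_monic _ _ _ w (char_poly (map_mx val A))).
- exact: char_poly_monic.
- by rewrite -eigenvalue_root_char.
- apply/integral_poly => i; rewrite -map_char_poly coef_map.
  exact/algintP/valP.
Qed.

(** Determinant trick: the generators satisfy $b = Ab$ with entries of $A$ in [C], and the adjugate
    gives $\det(1-A)\,b = 0$. So the determinant is 0, while it is 1 modulo [C]. *)
Lemma nakayama C J : nonzero J -> J `<=` C ** J -> C = idealT OK.
Proof.
move=> nzJ JCJ; apply: ideal_full; have [b Jb] := nonzero_spanned nzJ.
have M_ex (i : 'I_(size b)) : exists m : nat -> OK,
    (forall j, C (m j)) /\ b`_i = \sum_(j < size b) m j * b`_j.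
  have [m Cm bE] := idealM_spanned Jb (JCJ _ (spanned_mem i Jb)).
  by exists m.
have [M ME] := choice M_ex.
pose A : 'M[OK]_(size b) := \matrix_(i, j) M i j.
pose v : 'cV[OK]_(size b) := \col_i b`_i.
have Av : (1%:M - A) *m v = 0.
  rewrite mulmxBl mul1mx; apply/eqP; rewrite subr_eq0; apply/eqP/colP => i.
  by rewrite !mxE [LHS](ME i).2; apply: eq_bigr => j _; rewrite !mxE.
have dv : \det (1%:M - A) *: v = 0.
  by rewrite -mul_scalar_mx -mul_adj_mx -mulmxA Av mulmx0.
have [i bi] : exists i : 'I_(size b), b`_i != 0.
  have [a /Jb[m aE] a0] := nzJ; apply: contrapT => /forallNP b0.
  move/eqP: a0; apply; rewrite aE big1 // => i _.
  by have /negP/negPn/eqP-> := b0 i; rewrite mulr0.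
have d0 : \det (1%:M - A) = 0.
  apply/eqP; have /colP/(_ i)/eqP := dv.
  by rewrite !mxE OK_mul_eq0 (negbTE bi) orbF.
have := @det_sub1_ideal _ C _ A; rewrite d0 sub0r => C1.
rewrite -[1]opprK -mulN1r; apply: idealMl; apply: C1 => i' j.
by rewrite mxE; apply: (ME i').1.
Qed.

Lemma pideal_mulI a I J : a != 0 -> pideal a ** I = pideal a ** J -> I = J.
Proof.
suff sub I' J' : a != 0 -> pideal a ** I' = pideal a ** J' -> I' `<=` J'.
  by move=> a0 IJ; apply: ideal_eqP; apply: sub.
move=> a0 IJ x Ix; have : (pideal a ** J') (a * x).
  by rewrite -IJ; apply/pideal_mulP; exists x.
by move=> /pideal_mulP[y Jy /(OK_mulfI a0)->].
Qed.

(** The cofactor is $a^{-1}I$, which the inclusion makes integral. *)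
Lemma pideal_dvd a I : a != 0 -> I `<=` pideal a -> exists J, I = pideal a ** J.
Proof.
move=> a0 Ia.
have Jid : is_ideal [set x | I (a * x)].
  split=> /= [|x y|c x]; first by rewrite mulr0; apply: ideal0.
    by rewrite mulrDr; apply: idealD.
  by rewrite mulrCA; apply: idealMl.
exists (Ideal (asboolT Jid)); apply: ideal_eqP => x.
  move=> Ix; have [y xE] := Ia x Ix; apply/pideal_mulP; exists y; last
    by rewrite mulrC.
  by rewrite /ideal_mem /= mulrC -xE.
by move=> /pideal_mulP[y Iy ->].
Qed.

End IntegerIdeals.

(** * Coinciding ideal classes and invertibility of nonzero ideals *)

Section ClassNumber.
Variable K : fieldExtType rat.
Local Notation OK := (ringOfIntegers K).
Local Notation one := (idealT OK).
Local Notation "\prodI_ ( i <- r ) F" := (\big[@idealM OK/one]_(i <- r) F)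
  (at level 36, F at level 36, i, r at level 50).
Implicit Types (I J L C P : ideal OK) (a b c x y : OK) (l : seq (ideal OK)).

Lemma nonzero_fractional I : nonzero I -> is_fractional [set val x | x in I].
Proof.
move=> [a Ia a0]; split.
- by exists 0; [exact: ideal0 | rewrite rmorph0].
- move=> _ _ [x Ix <-] [y Iy <-].
  by exists (x + y); [exact: idealD | rewrite rmorphD].
- by move=> b _ [x Ix <-]; exists (b * x); [exact: idealMl | rewrite rmorphM].
- by exists (val a); [exists a | rewrite val_eq0].
- exists 1; first exact: oner_neq0.
  by move=> _ [x _ <-]; rewrite rmorph1 mul1r; apply: valP.
Qed.

Lemma class_pigeonhole h (A : nat -> ideal OK) :
  cyclic_of_order (classGroup K) h -> (forall i, nonzero (A i)) ->
  exists i j a b, [/\ (i < j <= h)%N, a != 0, b != 0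
    & pideal a ** A i = pideal b ** A j].
Proof.
move=> [_ /card_set_bijP[f [fh finj _]]] nzA.
pose F i := FractionalIdeal (asboolT (nonzero_fractional (nzA i))).
(* One index more than there are classes. *)
pose g (i : 'I_h.+1) : 'I_h := Ordinal (fh (class_of (F i)) I).
have [i [j [ij /class_ofP[w w0 FE]]]] :
    exists i j, (i < j <= h)%N /\ class_of (F i) = class_of (F j).
  apply: contrapT => nij; have : injective g; last first.
    by move=> /leq_card; rewrite !card_ord ltnn.
  move=> i j gij; have Fij : class_of (F i) = class_of (F j).
    by apply: finj; rewrite ?inE //; apply: (congr1 val gij).
  apply: val_inj; have [ij|ji|//] := ltngtP (i : nat) j; exfalso; apply: nij.
    by exists i, j; rewrite ij -ltnS ltn_ord.
  by exists j, i; rewrite ji -ltnS ltn_ord.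
have FP (z : K) : [set val x | x in A i] z <-> exists2 y, A j y & z = w * val y.
  have -> : [set val x | x in A i] = F i by [].
  rewrite FE; split=> [|[y Ay ->]]; last first.
    by apply: mulset_mem; [exists 1; rewrite rmorph1 mul1r | exists y].
  move: z; apply: mulset_min => [|u v [y Ay ->] [z Az ->]|_ _ [c ->] [y Ay <-]].
  - by exists 0; [exact: ideal0 | rewrite rmorph0 mulr0].
  - by exists (y + z); [exact: idealD | rewrite rmorphD mulrDr].
  - by exists (c * y); [exact: idealMl | rewrite rmorphM mulrCA mulrA].
have toAj (x : OK) : A i x -> exists2 y : OK, A j y & val x = w * val y.
  by move=> Ax; apply/FP; exists x.
have toAi (y : OK) : A j y -> exists2 x : OK, A i x & val x = w * val y.
  move=> Ay; have [x Ax xE] : [set val x | x in A i] (w * val y).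
    by apply/FP; exists y.
  by exists x.
(* [w] is the fraction [e / d]: with [d] taken in [A j], the product of [w] and [d] lies in [A i],
   hence in [OK]. *)
have [d Ad d0] := nzA j; have [e Ae wd] := toAi d Ad.
have e0 : e != 0 by rewrite -val_eq0 wd mulf_neq0 ?val_eq0.
exists i, j, d, e; split=> //; apply: ideal_eqP => _ /pideal_mulP[x Ax ->].
  have [y Ay xE] := toAj x Ax; apply/pideal_mulP; exists y => //;
    apply: val_inj.
  by rewrite !OK_valM wd xE mulrCA mulrA.
have [y Ay yE] := toAi x Ax; apply/pideal_mulP; exists y => //; apply: val_inj.
by rewrite !OK_valM wd yE mulrAC mulrC.
Qed.

Definition idealX I n := iter n (idealM I) one.

Lemma idealXD I m n : idealX I (m + n) = idealX I m ** idealX I n.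
Proof.
by elim: m => [|m IH]; rewrite ?mul_idealT // addSn /= IH idealMA.
Qed.

Lemma nonzeroX I n : nonzero I -> nonzero (idealX I n).
Proof.
by move=> nzI; elim: n => [|n IH]; [exact: nonzeroT | exact: nonzeroM].
Qed.

(** Invertibility as a fractional ideal, with inverse $a^{-1}J$, expressed by integral ideals
    alone. *)
Definition invertible I := exists J a, a != 0 /\ I ** J = pideal a.

Lemma nonzero_invertible h I :
  cyclic_of_order (classGroup K) h -> nonzero I -> invertible I.
Proof.
move=> hCl nzI.
have [i [j [a [b [/andP[ij _] a0 b0 abE]]]]] :=
  class_pigeonhole hCl (fun i => nonzeroX i nzI).
pose J := idealX I i; have nzJ : nonzero J by exact: nonzeroX.
(* The difference of the exponents is positive, so a factor [I] can be split off [C] at the end. *)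
have [d jE] : exists d, j = (d.+1 + i)%N.
  by exists (j - i.+1)%N; rewrite addSnnS subnK.
pose C := idealX I d.+1; rewrite jE idealXD -/C -/J in abE.
(* As $bCJ = aJ$, each [b * c] with [c] in [C] sends [J] into $aJ$. *)
have bC : pideal b ** C `<=` pideal a.
  move=> _ /pideal_mulP[c Cc ->].
  have [x Jx|y ->] := @integral_closed _ J a (b * c) nzJ a0; last first.
    by exists y; rewrite mulrC.
  apply/pideal_mulP; rewrite abE; apply/pideal_mulP.
  by exists (c * x); [exact: mulset_mem | rewrite mulrA].
have [C' C'E] := pideal_dvd a0 bC.
(* Cancelling [a] in $aC'J = bCJ = aJ$ gives $C'J = J$. *)
have C'1 : C' = one.
  apply: (nakayama nzJ); rewrite (_ : C' ** J = J) //.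
  by apply: (pideal_mulI a0); rewrite idealMA -C'E -idealMA abE.
exists (pideal b ** idealX I d), a; split=> //.
by rewrite idealMA (idealMC I) -idealMA -/(idealX I d.+1) C'E C'1 idealMC
  mul_idealT.
Qed.

Lemma invertible_mulI I J L : invertible I -> I ** J = I ** L -> J = L.
Proof.
move=> [I' [a [a0 aE]]] IJL; apply: (pideal_mulI a0).
by rewrite -aE (idealMC I) -!idealMA IJL.
Qed.

(** Multiplying the inclusion by [J'] gives $IJ' \subseteq (a)$, and $IJ'$ can be divided by [a]. *)
Lemma invertible_dvd I J : invertible J -> I `<=` J -> exists L, I = J ** L.
Proof.
move=> [J' [a [a0 aE]]] IJ.
have [L LE] : exists L, I ** J' = pideal a ** L.
  by apply: pideal_dvd => //; rewrite -aE; apply: idealMS.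
exists L; apply: (pideal_mulI a0).
by rewrite idealMA (idealMC _ J) -idealMA -LE -{1}aE (idealMC I) !idealMA.
Qed.

(** * Factorization into prime ideals *)

Lemma maximal_is_prime I :
  ~ I 1 -> (forall J, I `<=` J -> ~ J `<=` I -> J = one) -> is_prime_ideal I.
Proof.
move=> I1 Imax; split=> // [|x y Ixy]; first exact: idealP.
have [Ix|nIx] := pselect (I x); [by left | right].
(* Maximality gives $1 = i + rx$ with [i] in [I], whence $y = iy + rxy$ lies in [I]. *)
have : ideal_add I (pideal x) 1.
  rewrite (Imax (ideal_add I (pideal x))) // => [u Iu|Ix].
    by exists u => //; exists 0; [exact: (ideal0 (pideal x)) | rewrite addr0].
  apply/nIx/Ix; exists 0; first exact: ideal0.
  by exists x; [exists 1; rewrite mul1r | rewrite add0r].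
move=> [i Ii [_ [r ->] irE]]; rewrite -[y]mul1r -irE mulrDl; apply: idealD.
  by rewrite mulrC; apply: idealMl.
by rewrite -mulrA; apply: idealMl.
Qed.

Definition prime_seq l := forall P, P \in l -> is_prime_ideal P /\ nonzero P.

Lemma prime_factorization I : (forall J, nonzero J -> invertible J) ->
  nonzero I -> exists2 l, prime_seq l & I = \prodI_(P <- l) P.
Proof.
move=> inv; move: I; apply: noetherian_ind => I nzI IH.
have [I1|I1] := pselect (I 1).
  by exists [::] => //; rewrite big_nil; apply: ideal_full.
have [Imax|] := pselect (forall J, I `<=` J -> ~ J `<=` I -> J = one).
  exists [:: I]; last by rewrite big_seq1.
  by move=> P; rewrite inE => /eqP->; split=> //; apply: maximal_is_prime.
(* [M] lies strictly between [I] and the unit ideal. *)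
move=> /existsNP[M /not_implyP[IM /not_implyP[MI M1]]].
have nzM := nonzeroS IM nzI; have [J IE] := invertible_dvd (inv _ nzM) IM.
have IJ : I `<=` J by rewrite IE; apply: idealM_subr.
(* Were [J] equal to [I], cancelling [I] in $I = MJ$ would make [M] the unit ideal. *)
have JI : ~ J `<=` I.
  move=> JI; apply: M1; apply: (invertible_mulI (inv _ nzI)).
  by rewrite (idealMC _ one) mul_idealT idealMC [RHS]IE; congr idealM;
    apply: ideal_eqP.
have [l lP ME] := IH M IM MI; have [l' lP' JE] := IH J IJ JI.
exists (l ++ l'); last by rewrite big_cat IE ME JE.
by move=> P; rewrite mem_cat => /orP[/lP|/lP'].
Qed.

(** * Products of fewer than [h] nonprincipal primes *)

Definition nonprincipal_primes l :=
  forall P, P \in l -> [/\ is_prime_ideal P, nonzero P & ~ is_principal P].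

Lemma split_principal l : prime_seq l -> exists c l',
  nonprincipal_primes l' /\ \prodI_(P <- l) P = pideal c ** \prodI_(P <- l') P.
Proof.
elim: l => [|P l IH] lP.
  by exists 1, [::]; split=> //; rewrite pideal1 mul_idealT.
have [|c [l' [lP' lE]]] := IH.
  by move=> Q Ql; apply: lP; rewrite inE Ql orbT.
have [Pprime nzP] := lP P (mem_head _ _); rewrite big_cons lE.
have [[a PE]|nP] := pselect (is_principal P).
  exists (a * c), l'; split=> //; rewrite -pidealM -idealMA; congr idealM.
  exact: val_inj.
exists c, (P :: l'); split; last by rewrite big_cons !idealMA (idealMC P).
by move=> Q; rewrite inE => /orP[/eqP->|/lP'].
Qed.

Lemma shorten_product h l : cyclic_of_order (classGroup K) h ->
  (forall P, P \in l -> nonzero P) -> (h <= size l)%N ->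
  exists c l', [/\ subseq l' l, (size l' < size l)%N
    & \prodI_(P <- l) P = pideal c ** \prodI_(P <- l') P].
Proof.
move=> hCl nzl hl.
have nz_prod l' : {subset l' <= l} -> nonzero (\prodI_(P <- l') P).
  by move=> l'l; rewrite big_seq; apply: nonzero_prod => P /l'l/nzl.
(* As [h <= size l], the indices from 0 to [h] are lengths of actual prefixes. *)
have [i [j [a [b [/andP[ij jh] a0 b0 abE]]]]] := class_pigeonhole hCl
  (fun i => nz_prod (take i l) (fun P => @mem_take _ _ _ _)).
have lE : l = take i l ++ drop i (take j l) ++ drop j l.
  by rewrite catA -{1}(take_takel l (ltnW ij)) !cat_take_drop.
have jl : (j <= size l)%N by apply: leq_trans hl.
pose B := \prodI_(P <- drop i (take j l)) P.
have AjE : \prodI_(P <- take j l) P = \prodI_(P <- take i l) P ** B.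
  by rewrite -big_cat -{1}(take_takel l (ltnW ij)) cat_take_drop.
(* The prefix product $A_i$ is cancelled in $aA_i = bA_iB$. *)
have aB : pideal a = pideal b ** B.
  apply: (@invertible_mulI (\prodI_(P <- take i l) P)).
    by apply: (nonzero_invertible hCl); apply: nz_prod => P; apply: mem_take.
  by rewrite idealMC abE AjE idealMA (idealMC (pideal b)) -idealMA.
(* [a] itself lies in $(a) = bB$, which provides the generator of [B]. *)
have [c Bc aE] : exists2 c, B c & a = b * c.
  by apply/pideal_mulP; rewrite -aB; exists 1; rewrite mul1r.
have BE : B = pideal c by apply: (pideal_mulI b0); rewrite -aB pidealM -aE.
exists c, (take i l ++ drop j l); split.
- rewrite [X in subseq _ X]lE cat_subseq ?subseq_refl //; exact: suffix_subseq.
- rewrite size_cat size_drop size_takel ?(leq_trans (ltnW ij)) //.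
  by rewrite -{2}(subnKC jl) ltn_add2r.
- by rewrite {1}lE !big_cat /= -/B BE idealMA (idealMC _ (pideal c)) -idealMA.
Qed.

Lemma bounded_factorization h I : cyclic_of_order (classGroup K) h ->
  nonzero I -> exists c l, [/\ nonprincipal_primes l, (size l < h)%N
    & I = pideal c ** \prodI_(P <- l) P].
Proof.
move=> hCl nzI.
pose fact n := exists c l,
  [/\ nonprincipal_primes l, size l = n & I = pideal c ** \prodI_(P <- l) P].
have ex_fact : exists n, `[< fact n >].
  have [l lP IE] := prime_factorization (fun J => @nonzero_invertible h J hCl)
    nzI.
  have [c [l' [lP' lE]]] := split_principal lP.
  by exists (size l'); apply/asboolP; exists c, l'; rewrite -lE.
have [_ /asboolP[c [l [lP <- IE]]] l_min] := ex_minnP ex_fact.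
exists c, l; split=> //; rewrite ltnNge; apply/negP => hl.
(* A shorter factorization contradicts minimality; a subsequence still consists of nonprincipal
   primes. *)
have [|d [l' [l'l ll' lE]]] := shorten_product hCl _ hl; first
  by move=> P /lP[].
have : (size l <= size l')%N; last by rewrite leqNgt ll'.
apply: l_min; apply/asboolP; exists (c * d), l'; split=> //.
  by move=> P /(mem_subseq l'l)/lP.
by rewrite IE lE idealMA pidealM.
Qed.

(** * Regrouping a list of primes into powers of distinct ideals *)

Lemma ideal_set_prodX m (T : 'I_m -> ideal OK) (e : 'I_m -> nat) :
  ideal_set (\big[@idealM OK/one]_(i < m) idealX (T i) (e i)) =
  \big[@mulset OK/setT]_(i < m) expset (T i) (e i).
Proof.
rewrite (@big_morph _ _ (@ideal_set OK) setT (@mulset OK)) //.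
by apply: eq_bigr => i _; elim: (e i) => //= n ->.
Qed.

(** Equal factors are collected: the exponent of each distinct ideal is its multiplicity in [l]. *)
Lemma prod_undup l : \prodI_(P <- l) P =
  \big[@idealM OK/one]_(i < size (undup l))
    idealX (nth one (undup l) i) (count_mem (nth one (undup l) i) l).
Proof.
rewrite -(big_undup_iterop_count (@idealM OK)) (big_nth one) big_mkord.
by apply: eq_bigr => i _; rewrite Monoid.iteropE.
Qed.

Lemma sum_count_undup l :
  (\sum_(i < size (undup l)) count_mem (nth one (undup l) i) l)%N = size l.
Proof.
rewrite -(big_mkord xpredT (fun i => count_mem (nth one (undup l) i) l)).
(* With [size l] written as a sum of ones, this is the same regrouping for addition. *)
rewrite -(big_nth one xpredT (fun P => count_mem P l)) -sum1_size.
rewrite -[RHS](big_undup_iterop_count addn); apply: eq_bigr => P _.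
by rewrite Monoid.iteropE iter_addn_0 mul1n.
Qed.

End ClassNumber.

(** * Arbitrary ideals, the zero ideal treated apart *)

Theorem theorem1 (K : fieldExtType rat) (h : nat)
    (hCl : cyclic_of_order (classGroup K) h)
    (I : set (ringOfIntegers K)) (hI : is_ideal I) :
  exists (gamma : ringOfIntegers K) (m : nat)
         (T : 'I_m -> set (ringOfIntegers K)) (c : 'I_m -> nat),
    (forall i : 'I_m, is_ideal (T i)) /\
    injective T /\
    (\sum_(i < m) c i <= h - 1)%N /\
    I = mulset (principal gamma)
               (\big[@mulset (ringOfIntegers K) / setT]_(i < m) expset (T i) (c i)) /\
    (forall i : 'I_m,
       (is_prime_ideal (T i) /\ ~ is_principal (T i)) \/ T i = setT).
Proof.
pose J := Ideal (asboolT hI); have -> : I = ideal_set J by [].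
have [nzJ|zJ] := pselect (nonzero J); last first.
  (* The zero ideal is $(0)$ times the empty product. *)
  exists 0, 0%N, (fun=> setT), (fun=> 0%N); rewrite !big_ord0.
  split; [by case | split; [by case | split => //; split; last by case]].
  have -> : J = pideal 0 ** idealT _.
    apply: ideal_eqP => [x Jx|_ /pideal_mulP[y _ ->]]; last first.
      by rewrite mul0r; exact: (ideal0 J).
    rewrite idealMC mul_idealT; exists 0; rewrite mulr0;
      apply/eqP/negPn/negP => x0.
    by apply: zJ; exists x.
  by [].
have [gamma [l [lP lh JE]]] := bounded_factorization hCl nzJ.
pose T (i : 'I_(size (undup l))) := nth (idealT _) (undup l) i.
have Tl i : T i \in l by rewrite -mem_undup mem_nth.
exists gamma, (size (undup l)), T, (fun i => count_mem (T i) l).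
split=> [i|]; first exact: idealP.
(* Different positions of a duplicate-free list hold different ideals. *)
split=> [i j Tij|].
  apply/val_inj/eqP;
    rewrite -(nth_uniq (idealT _) (ltn_ord i) (ltn_ord j) (undup_uniq l)).
  by apply/eqP/val_inj.
(* [size l < h] makes [h] positive, so the truncated [h - 1] is its predecessor. *)
split; first
  by rewrite sum_count_undup leq_subRL ?add1n // (leq_ltn_trans _ lh).
split=> [|i]; last by left; have [] := lP _ (Tl i).
by rewrite -ideal_set_prodX JE prod_undup.
Qed.
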